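(* Let $F$ be a field of characteristic $0$ and let $x^*_0,\ldots,x^*_4\in\mathbb{P}^2_{F[\varepsilon]_2}$ be $5$ points in generic position, $x^*_i=x_i+x'_i\varepsilon$. Then $$\sum_{i=0}^4(-1)^i\left\langle r(x_i|x_0,\ldots,\hat{x}_i,\ldots,x_4);\,r_\varepsilon(x^*_i|x^*_0,\ldots,\hat{x}^*_i,\ldots,x^*_4)\right]_2=0\in T\mathcal{B}_2(F).$$
   Context: $F[\varepsilon]_2=F[\varepsilon]/\varepsilon^2$. Each point $x^*_i$ of $\mathbb{P}^2_{F[\varepsilon]_2}$ is represented by a vector $x_i+x'_i\varepsilon\in F[\varepsilon]_2^3$ with $x_i,x_i'\in F^3$, $x_i\neq0$. $\Delta$ is the $3\times3$ determinant; generic position means $\Delta(x_i,x_j,x_k)\ne0$ for pairwise distinct $i,j,k$. **Projected cross-ratio.** For distinct indices, $$\mathbf{r}(x^*_i|x^*_j,x^*_k,x^*_l,x^*_m)=\frac{\Delta(x^*_i,x^*_j,x^*_m)\,\Delta(x^*_i,x^*_k,x^*_l)}{\Delta(x^*_i,x^*_j,x^*_l)\,\Delta(x^*_i,x^*_k,x^*_m)}=r(x_i|x_j,x_k,x_l,x_m)+r_\varepsilon(x^*_i|x^*_j,x^*_k,x^*_l,x^*_m)\,\varepsilon\in F[\varepsilon]_2,$$ i.e. $r$ and $r_\varepsilon$ are the coefficients of $\varepsilon^0$ and $\varepsilon^1$ of the cross-ratio of the four points projected from the fifth. **The group $T\mathcal{B}_2(F)$.** It is the $\mathbb{Z}$-module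 generated by the elements $\langle a;a']:=[a+a'\varepsilon]-[a]\in\mathbb{Z}[F[\varepsilon]_2]$ ($a,a'\in F$, $a\ne0,1$) modulo the five-term relations $$\langle a;a']-\langle b;b']+\Big\langle\tfrac ba;\big(\tfrac ba\big)'\Big]-\Big\langle\tfrac{1-b}{1-a};\big(\tfrac{1-b}{1-a}\big)'\Big]+\Big\langle\tfrac{a(1-b)}{b(1-a)};\big(\tfrac{a(1-b)}{b(1-a)}\big)'\Big]=0,\qquad a,b\neq0,1,\ a\neq b,$$ with $\big(\tfrac ba\big)'=\tfrac{ab'-a'b}{a^2}$, $\big(\tfrac{1-b}{1-a}\big)'=\tfrac{(1-b)a'-(1-a)b'}{(1-a)^2}$, $\big(\tfrac{a(1-b)}{b(1-a)}\big)'=\tfrac{b(1-b)a'-a(1-a)b'}{(b(1-a))^2}$. The class of $\langle a;b]$ is written $\langle a;b]_2$. *)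

(* Defs.v *)
From HB Require Import structures.
From mathcomp Require Import all_boot all_algebra.
From mathcomp Require Import qpoly ring_quotient ring.
From mathcomp Require Import boolp.
From mathcomp.multinomials Require Import freeg.

Set Implicit Arguments.
Unset Strict Implicit.
Unset Printing Implicit Defensive.

Import GRing.Theory Quotient.

Local Open Scope ring_scope.
Local Open Scope quotient_scope.

Inductive zspan (V : zmodType) (S : V -> Prop) : V -> Prop :=
| zspan_gen x of S x : zspan S x
| zspan_zero : zspan S 0
| zspan_sub x y of zspan S x & zspan S y : zspan S (x - y).

Section SpannedSubgroup.
Variables (V : zmodType) (S : V -> Prop).

Definition zspan_pred : pred V := fun x => `[< zspan S x >].

Lemma zspan_predP x : reflect (zspan S x) (x \in zspan_pred).
Proof. exact: asboolP. Qed.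

Fact zspan_zmod_closed : zmod_closed zspan_pred.
Proof.
split=> [|x y /zspan_predP Sx /zspan_predP Sy]; apply/zspan_predP.
  exact: zspan_zero.
exact: zspan_sub.
Qed.

HB.instance Definition _ :=
  GRing.isZmodClosed.Build V zspan_pred zspan_zmod_closed.

Record zspan_type := ZspanElt {
  zspan_val : V;
  _ : zspan_val \in zspan_pred
}.

HB.instance Definition _ := [isSub for zspan_val].
HB.instance Definition _ := [Choice of zspan_type by <:].
HB.instance Definition _ := [SubChoice_isSubZmodule of zspan_type by <:].

Definition zquot : zmodType := {quot (GRing.ZmodClosed.clone V zspan_pred _)}.

Definition zquot_pi : V -> zquot :=
  \pi_({quot (GRing.ZmodClosed.clone V zspan_pred _)}).

Lemma zquot_pi_is_zmod_morphism : zmod_morphism zquot_pi.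
Proof. exact: pi_is_zmod_morphism. Qed.

HB.instance Definition _ :=
  GRing.isZmodMorphism.Build V zquot zquot_pi zquot_pi_is_zmod_morphism.

Lemma zquot_pi_eq0 x : zquot_pi x = 0 <-> zspan S x.
Proof.
have e : (x \in zspan_pred) = (zquot_pi x == 0).
  rewrite -(raddf0 zquot_pi) -[x in LHS]subr0.
  exact: (idealrBE (GRing.ZmodClosed.clone V zspan_pred _)).
split=> [/eqP | /zspan_predP]; first by rewrite -e => /zspan_predP.
by rewrite e => /eqP.
Qed.

End SpannedSubgroup.

Notation dual_ring F := {poly %/ ('X^2 : {poly F})}.

Section TangentBlochGroup.
Variable F : fieldType.

(* a + a' eps: 'qX is the class of 'X, i.e. eps *)
Definition dual (a a' : F) : dual_ring F :=
  qpolyC 'X^2 a + qpolyC 'X^2 a' * 'qX.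

Definition tbracket (a a' : F) : {freeg (dual_ring F) / int} :=
  << dual a a' >> - << dual a 0 >>.

Definition tbracket_gen (g : {freeg (dual_ring F) / int}) : Prop :=
  exists a a' : F, [/\ a != 0, a != 1 & g = tbracket a a'].

Definition five_term (a a' b b' : F) : {freeg (dual_ring F) / int} :=
  tbracket a a' - tbracket b b'
  + tbracket (b / a) ((a * b' - a' * b) / a ^+ 2)
  - tbracket ((1 - b) / (1 - a))
             (((1 - b) * a' - (1 - a) * b') / (1 - a) ^+ 2)
  + tbracket ((a * (1 - b)) / (b * (1 - a)))
             ((b * (1 - b) * a' - a * (1 - a) * b') / (b * (1 - a)) ^+ 2).

Definition five_term_rel (g : zspan_type tbracket_gen) : Prop :=
  exists a a' b b' : F,
    [/\ [/\ a != 0 & a != 1], [/\ b != 0 & b != 1], a != b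
      & val g = five_term a a' b b'].

Definition TB2 : zmodType := zquot five_term_rel.

(* The class of the generator <a; a'] for a != 0, 1. For a = 0 or a = 1, where
   <a; a'] is not defined, insubd returns the junk value 0; by cross_ratio_neq0
   and cross_ratio_neq1 this does not happen at cross-ratios of points in
   generic position. *)
Definition tclass (a a' : F) : TB2 := zquot_pi _ (insubd 0 (tbracket a a')).

Lemma val_tbracket (a a' : F) : a != 0 -> a != 1 ->
  val (insubd (0 : zspan_type tbracket_gen) (tbracket a a')) = tbracket a a'.
Proof.
move=> a0 a1; rewrite insubdK //.
by apply/zspan_predP/zspan_gen; exists a, a'.
Qed.

Lemma five_term_in (a a' b b' : F) : a != 0 -> a != 1 -> b != 0 -> b != 1 ->
  a != b -> five_term a a' b b' \in zspan_pred tbracket_gen.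
Proof.
have tin c c' : c != 0 -> c != 1 -> tbracket c c' \in zspan_pred tbracket_gen.
  by move=> c0 c1; apply/zspan_predP/zspan_gen; exists c, c'.
move=> a0 a1 b0 b1 ab.
have Na1 : 1 - a != 0 by rewrite subr_eq0 eq_sym.
have Nb1 : 1 - b != 0 by rewrite subr_eq0 eq_sym.
have Nbd : b * (1 - a) != 0 by rewrite mulf_neq0.
have div_neq1 (c d : F) : d != 0 -> c != d -> c / d != 1.
  by move=> d0; apply: contra => /eqP e; rewrite -[c](divfK d0) e mul1r.
rewrite /five_term; apply: rpredD; last first.
  apply: tin; first by rewrite !(mulf_neq0, invr_eq0).
  apply: div_neq1 => //; apply: contra ab => /eqP e; apply/eqP.
  by move: e; rewrite !mulrBr !mulr1 [b * a]mulrC => /addIr.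
apply: rpredB; last first.
  apply: tin; first by rewrite !(mulf_neq0, invr_eq0).
  by apply: div_neq1 => //; apply: contra ab => /eqP /addrI /oppr_inj ->.
apply: rpredD; last first.
  apply: tin; first by rewrite !(mulf_neq0, invr_eq0).
  by apply: div_neq1; rewrite // eq_sym.
by apply: rpredB; apply: tin.
Qed.

End TangentBlochGroup.

Section CrossRatio.
Variable R : comUnitRingType.

Definition Delta (u v w : 'rV[R]_3) : R :=
  \det (\matrix_(i < 3) nth 0 [:: u; v; w] i).

Definition cross_ratio (xi xj xk xl xm : 'rV[R]_3) : R :=
  (Delta xi xj xm * Delta xi xk xl) / (Delta xi xj xl * Delta xi xk xm).

(* r(x_i | x_0, .., x_i omitted, .., x_4): fintype.lift i enumerates the
   indices other than i in increasing order. *)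
Definition cross_ratio_hat (x : 'I_5 -> 'rV[R]_3) (i : 'I_5) : R :=
  let y (j : 'I_4) := x (fintype.lift i j) in
  cross_ratio (x i) (y (inord 0)) (y (inord 1)) (y (inord 2)) (y (inord 3)).

Lemma DeltaE u v w : Delta u v w =
  u 0 0 * (v 0 1 * w 0 2%:R - v 0 2%:R * w 0 1)
  - u 0 1 * (v 0 0 * w 0 2%:R - v 0 2%:R * w 0 0)
  + u 0 2%:R * (v 0 0 * w 0 1 - v 0 1 * w 0 0).
Proof.
rewrite /Delta (expand_det_row _ 0) !big_ord_recl big_ord0.
rewrite /cofactor !(expand_det_row _ 0) !big_ord_recl !big_ord0.
rewrite /cofactor !det_mx11 !mxE /=.
have [f fE] : exists f : 'rV[R]_3 -> nat -> R, 
    forall (z : 'rV[R]_3) (i : 'I_3), z 0 i = f z i.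
  by exists (fun z n => z 0 (inord n)) => z i; rewrite inord_val.
rewrite !fE /= /bump /=; ring.
Qed.

End CrossRatio.


Section GenericPosition.
Variables (F : fieldType) (xi xj xk xl xm : 'rV[F]_3).
Hypotheses (Dijl : Delta xi xj xl != 0) (Dikm : Delta xi xk xm != 0).

Lemma cross_ratio_neq0 : Delta xi xj xm != 0 -> Delta xi xk xl != 0 ->
  cross_ratio xi xj xk xl xm != 0.
Proof. by move=> ? ?; rewrite !(mulf_neq0, invr_eq0). Qed.

Lemma cross_ratio_neq1 : Delta xi xj xk != 0 -> Delta xi xl xm != 0 ->
  cross_ratio xi xj xk xl xm != 1.
Proof.
move=> Dijk Dilm; apply/eqP => e.
have Dn0 : Delta xi xj xl * Delta xi xk xm != 0 by rewrite mulf_neq0.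
have: Delta xi xj xm * Delta xi xk xl = Delta xi xj xl * Delta xi xk xm.
  by move: e; rewrite /cross_ratio => /(divr1_eq) .
move/eqP; apply/negP; rewrite -subr_eq0.
suff ->: Delta xi xj xm * Delta xi xk xl - Delta xi xj xl * Delta xi xk xm
         = - (Delta xi xj xk * Delta xi xl xm).
  by rewrite oppr_eq0 mulf_neq0.
by rewrite !DeltaE; ring.
Qed.

End GenericPosition.

Definition coef_eps0 (F : fieldType) (z : dual_ring F) : F := (z : {poly F})`_0.
Definition coef_eps1 (F : fieldType) (z : dual_ring F) : F := (z : {poly F})`_1.

Section DualPoints.
Variable F : fieldType.

Definition dual_row (x x' : 'rV[F]_3) : 'rV[dual_ring F]_3 :=
  map2_mx (@dual F) x x'.

Definition r_eps (x x' : 'I_5 -> 'rV[F]_3) (i : 'I_5) : F :=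
  coef_eps1 (cross_ratio_hat (fun j => dual_row (x j) (x' j)) i).

Lemma dual_polyE (a a' : F) : dual a a' = a%:P + a'%:P * 'X :> {poly F}.
Proof.
rewrite /dual poly_of_qpolyD poly_of_qpolyM !qpolyCE qpolyXE ?size_polyXn //.
  by rewrite mk_monic_Xn Pdiv.Ring.rmodp_small // size_polyXn mul_polyC
             (leq_ltn_trans (size_scale_leq _ _)) // size_polyX.
exact: monicXn.
Qed.

Lemma coef_eps0_dual (a a' : F) : coef_eps0 (dual a a') = a.
Proof. by rewrite /coef_eps0 dual_polyE coefD coefC coefMX addr0. Qed.

Lemma coef_eps1_dual (a a' : F) : coef_eps1 (dual a a') = a'.
Proof. by rewrite /coef_eps1 dual_polyE coefD coefC coefMX coefC add0r. Qed.

Fact coef_eps0_is_zmod_morphism : zmod_morphism (@coef_eps0 F).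
Proof. by move=> x y; rewrite /coef_eps0 coefB. Qed.

Fact coef_eps0_is_monoid_morphism : monoid_morphism (@coef_eps0 F).
Proof.
split=> [|x y]; first by rewrite /coef_eps0 coefC.
rewrite /coef_eps0 poly_of_qpolyM.
move: (polyn x) (polyn y) => p q; rewrite mk_monic_Xn -coef0M.
rewrite [in RHS](Pdiv.RingMonic.rdivp_eq (monicXn F 2) (p * q)).
by rewrite coefD coefMXn add0r.
Qed.

HB.instance Definition _ := GRing.isZmodMorphism.Build (dual_ring F) F
  (@coef_eps0 F) coef_eps0_is_zmod_morphism.
HB.instance Definition _ := GRing.isMonoidMorphism.Build (dual_ring F) F
  (@coef_eps0 F) coef_eps0_is_monoid_morphism.

Lemma dual_unit (z : dual_ring F) : (z \is a GRing.unit) = (coef_eps0 z != 0).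
Proof.
rewrite -[LHS]/(coprimep (mk_monic 'X^2) z) /coef_eps0.
move: (polyn z) => p; rewrite mk_monic_Xn coprimep_sym.
by rewrite coprimep_pexpr // coprimepX rootE horner_coef0.
Qed.

Lemma coef_eps0M (z t : dual_ring F) :
  coef_eps0 (z * t) = coef_eps0 z * coef_eps0 t.
Proof. exact: (rmorphM (@coef_eps0 F)). Qed.

Lemma coef_eps0V (z : dual_ring F) :
  coef_eps0 z != 0 -> coef_eps0 z^-1 = (coef_eps0 z)^-1.
Proof. by rewrite -dual_unit => zU; exact: (rmorphV (@coef_eps0 F) zU). Qed.

Lemma coef_eps0_quot (z1 z2 z3 z4 : dual_ring F) :
    coef_eps0 z3 != 0 -> coef_eps0 z4 != 0 ->
  coef_eps0 (z1 * z2 / (z3 * z4))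
  = coef_eps0 z1 * coef_eps0 z2 / (coef_eps0 z3 * coef_eps0 z4).
Proof.
move=> z3U z4U.
by rewrite coef_eps0M coef_eps0V coef_eps0M ?coef_eps0M ?mulf_neq0.
Qed.

Lemma coef_eps0_Delta (u u' v v' w w' : 'rV[F]_3) :
  coef_eps0 (Delta (dual_row u u') (dual_row v v') (dual_row w w'))
  = Delta u v w.
Proof.
rewrite !DeltaE !(rmorphD, rmorphN, rmorphM) /= !mxE.
by rewrite !coef_eps0_dual.
Qed.

Lemma coef_eps0_cross_ratio (xi xi' xj xj' xk xk' xl xl' xm xm' : 'rV[F]_3) :
    Delta xi xj xl != 0 -> Delta xi xk xm != 0 ->
  coef_eps0 (cross_ratio (dual_row xi xi') (dual_row xj xj') (dual_row xk xk')
                         (dual_row xl xl') (dual_row xm xm'))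
  = cross_ratio xi xj xk xl xm.
Proof.
rewrite /cross_ratio -(coef_eps0_Delta xi xi' xj xj' xl xl').
rewrite -(coef_eps0_Delta xi xi' xk xk' xm xm').
rewrite -(coef_eps0_Delta xi xi' xj xj' xm xm').
rewrite -(coef_eps0_Delta xi xi' xk xk' xl xl').
exact: coef_eps0_quot.
Qed.

Lemma coef_eps0_cross_ratio_hat (x x' : 'I_5 -> 'rV[F]_3) (i : 'I_5) :
    (forall i j k, i != j -> i != k -> j != k -> Delta (x i) (x j) (x k) != 0) ->
  coef_eps0 (cross_ratio_hat (fun j => dual_row (x j) (x' j)) i)
  = cross_ratio_hat x i.
Proof.
move=> gen; rewrite /cross_ratio_hat /=.
have lift_neq (j k : 'I_4) : j != k -> fintype.lift i j != fintype.lift i k.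
  by rewrite (inj_eq lift_inj).
apply: coef_eps0_cross_ratio;
  by rewrite gen ?neq_lift ?lift_neq // -val_eqE /= !inordK.
Qed.

End DualPoints.

(* Main.v *)
Require Import Defs.
From mathcomp Require Import all_boot all_algebra.
From mathcomp Require Import qpoly ring.
From mathcomp.multinomials Require Import freeg.

(* Write r_i for the i-th projected cross-ratio in F[eps]. The five-term
   relation at (r_0, r_1) has the arguments r_0, r_1, r_2, 1 / r_4, 1 / r_3,
   so it remains to see that <1 / z] = - <z]. Adding the five-term relations
   at (x, y) and (y, x) shows that s(z) = <z] + <1 / z] satisfies
   s(t) + s(t u) = s(u). Hence s(w^2) = 0 (take t = u = w), and s vanishes on
   constants because <a; 0] = 0; in characteristic 0 every z is a constant
   times a square. *)

Set Implicit Arguments.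
Unset Strict Implicit.
Unset Printing Implicit Defensive.

Import GRing.Theory.

Local Open Scope ring_scope.

(** * Determinant identities and cross-ratios over a commutative ring with units *)

Section UnitRing.
Variable R : comUnitRingType.
Implicit Types a b c e : R.

Lemma eq_divr a b c : b \is a GRing.unit -> a = c * b -> a / b = c.
Proof. by move=> bU ->; rewrite mulrK. Qed.

Lemma invr_div a b :
  a \is a GRing.unit -> b \is a GRing.unit -> (a / b)^-1 = b / a.
Proof. by move=> aU bU; rewrite invrM ?unitrV // invrK. Qed.

Lemma Delta_swap12 (u v w : 'rV[R]_3) : Delta v u w = - Delta u v w.
Proof. by rewrite !DeltaE; ring. Qed.

Lemma Delta_swap23 (u v w : 'rV[R]_3) : Delta u w v = - Delta u v w.
Proof. by rewrite !DeltaE; ring. Qed.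

(** The three-term Plücker relation for four points projected from [xi]. *)
Lemma Delta_plucker (xi xj xk xl xm : 'rV[R]_3) :
  Delta xi xj xl * Delta xi xk xm - Delta xi xj xm * Delta xi xk xl =
  Delta xi xj xk * Delta xi xl xm.
Proof. by rewrite !DeltaE; ring. Qed.

Lemma subr1_cross_ratio (xi xj xk xl xm : 'rV[R]_3) :
    Delta xi xj xl \is a GRing.unit -> Delta xi xk xm \is a GRing.unit ->
  1 - cross_ratio xi xj xk xl xm =
  (Delta xi xj xk * Delta xi xl xm) / (Delta xi xj xl * Delta xi xk xm).
Proof.
move=> Ujl Ukm; rewrite -Delta_plucker mulrBl divrr //.
by rewrite unitrM Ujl Ukm.
Qed.

Lemma eqr_div_units a b c e : b \is a GRing.unit -> e \is a GRing.unit ->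
  a * e = c * b -> a / b = c / e.
Proof.
by move=> bU eU ae; apply: eq_divr; rewrite // mulrAC -ae mulrK.
Qed.

Lemma mulr_div a b c e : b \is a GRing.unit -> e \is a GRing.unit ->
  (a / b) * (c / e) = (a * c) / (b * e).
Proof. by move=> bU eU; rewrite mulrACA -invrM // [e * b]mulrC. Qed.

(** * Relations among the five projected cross-ratios *)

Section FivePoints.
Variable p : 'I_5 -> 'rV[R]_3.
Hypothesis pU : forall i j k, i != j -> i != k -> j != k ->
  Delta (p i) (p j) (p k) \is a GRing.unit.

Let lift_neq (i : 'I_5) (j k : 'I_4) :
  (fintype.lift i j != fintype.lift i k) = (j != k).
Proof. by rewrite (inj_eq lift_inj). Qed.

Lemma cross_ratio_hat_unit i : cross_ratio_hat p i \is a GRing.unit.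
Proof.
by rewrite /cross_ratio_hat !(unitrM, unitrV) !pU ?neq_lift ?lift_neq //;
   rewrite -val_eqE /= !inordK.
Qed.

(** By Plücker, the difference is again a quotient of products of determinants. *)
Lemma subr1_cross_ratio_hat_unit i :
  1 - cross_ratio_hat p i \is a GRing.unit.
Proof.
rewrite /cross_ratio_hat subr1_cross_ratio ?(unitrM, unitrV) ?pU //;
  by rewrite ?neq_lift ?lift_neq // -val_eqE /= !inordK.
Qed.

Let q n := p (inord n).
Let d i j k := Delta (q i) (q j) (q k).
Let r n := cross_ratio_hat p (inord n).

Let dU i j k : (i < 5)%N -> (j < 5)%N -> (k < 5)%N ->
  i != j -> i != k -> j != k -> d i j k \is a GRing.unit.
Proof.
by move=> i5 j5 k5 *; apply: pU; rewrite -val_eqE /= !inordK.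
Qed.

(** Replaces ordinals by natural numbers: the list hypothesis, which names the four indices left
    after omitting [i], is settled by evaluation. *)
Let rE (i j k l m : nat) :
    (i < 5)%N ->
    [seq bump i n | n <- iota 0 4] = [:: j; k; l; m] ->
  r i = cross_ratio (q i) (q j) (q k) (q l) (q m).
Proof.
move=> i5 [ej ek el em].
have liftE n : (n < 4)%N ->
    fintype.lift (inord i : 'I_5) (inord n : 'I_4) = inord (bump i n).
  move=> n4; apply: val_inj; rewrite /= !inordK //.
  by rewrite /bump; case: (i <= n)%N; rewrite ?add1n ?add0n ?ltnS // ltnW.
rewrite /r /cross_ratio_hat !liftE //.
by rewrite ej ek el em.
Qed.

(** Here and below all determinants are brought to increasing indices, so that equal ones become
    identical factors; the signs from the reordering cancel. *)
Let r0E : r 0 = (d 0 1 4 * d 0 2 3) / (d 0 1 3 * d 0 2 4).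
Proof. exact: (@rE 0 1 2 3 4). Qed.

Let r1E : r 1 = (d 0 1 4 * d 1 2 3) / (d 0 1 3 * d 1 2 4).
Proof.
rewrite (@rE 1 0 2 3 4) // /cross_ratio.
by rewrite !(Delta_swap12 (q 0) (q 1)) !mulNr invrN mulrN opprK.
Qed.

Let r2E : r 2 = (d 0 2 4 * d 1 2 3) / (d 0 2 3 * d 1 2 4).
Proof.
rewrite (@rE 2 0 1 3 4) // /cross_ratio.
by rewrite !(Delta_swap12 _ (q 2)) !mulrNN.
Qed.

Let r3E : r 3 = (d 0 3 4 * d 1 2 3) / (d 0 2 3 * d 1 3 4).
Proof.
rewrite (@rE 3 0 1 2 4) // /cross_ratio.
rewrite !(Delta_swap12 _ (q 3)) !(Delta_swap23 _ (q 2) (q 3)) !opprK.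
by rewrite mulNr mulrN invrN mulrNN.
Qed.

Let r4E : r 4 = (d 0 3 4 * d 1 2 4) / (d 0 2 4 * d 1 3 4).
Proof.
rewrite (@rE 4 0 1 2 3) // /cross_ratio.
by rewrite !(Delta_swap12 _ (q 4)) !(Delta_swap23 _ _ (q 4)) !opprK.
Qed.

Let subr1_r0 : 1 - r 0 = (d 0 1 2 * d 0 3 4) / (d 0 1 3 * d 0 2 4).
Proof. by rewrite (@rE 0 1 2 3 4) // subr1_cross_ratio // dU. Qed.

Let subr1_r1 : 1 - r 1 = (d 0 1 2 * d 1 3 4) / (d 0 1 3 * d 1 2 4).
Proof.
rewrite (@rE 1 0 2 3 4) // subr1_cross_ratio ?pU -?val_eqE /= ?inordK //.
by rewrite !(Delta_swap12 (q 0) (q 1)) !mulNr invrN mulrN opprK.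
Qed.

(** For this quotient and the next two, cross-multiplication leaves equal products of determinants;
    Plücker enters only through [subr1_r0] and [subr1_r1]. *)
Lemma cross_ratio_hat_div : r 1 / r 0 = r 2.
Proof.
apply: eq_divr; first exact: cross_ratio_hat_unit.
rewrite r0E r1E r2E mulr_div ?unitrM ?dU //.
by apply: eqr_div_units; rewrite ?unitrM ?dU //; ring.
Qed.

Lemma cross_ratio_hat_subr1_div : (1 - r 1) / (1 - r 0) = (r 4)^-1.
Proof.
apply: eq_divr; first exact: subr1_cross_ratio_hat_unit.
rewrite subr1_r0 subr1_r1 r4E invr_div ?unitrM ?dU //.
rewrite mulr_div ?unitrM ?dU //.
by apply: eqr_div_units; rewrite ?unitrM ?dU //; ring.
Qed.

Lemma cross_ratio_hat_mul_div :
  (r 0 * (1 - r 1)) / (r 1 * (1 - r 0)) = (r 3)^-1.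
Proof.
apply: eq_divr.
  by rewrite unitrM cross_ratio_hat_unit subr1_cross_ratio_hat_unit.
rewrite subr1_r0 subr1_r1 r0E r1E r3E invr_div ?unitrM ?dU //.
rewrite !mulr_div ?unitrM ?dU //.
by apply: eqr_div_units; rewrite ?unitrM ?dU //; ring.
Qed.

Lemma subr_cross_ratio_hat_unit : r 0 - r 1 \is a GRing.unit.
Proof.
have -> : r 0 - r 1 = r 0 * (1 - r 2).
  by rewrite -cross_ratio_hat_div mulrBr mulr1 mulrC divrK ?cross_ratio_hat_unit.
by rewrite unitrM cross_ratio_hat_unit subr1_cross_ratio_hat_unit.
Qed.

End FivePoints.

End UnitRing.

Lemma alternating_sum5 (V : zmodType) (f : 'I_5 -> V) :
  \sum_(i < 5) f i *~ ((-1) ^+ i) =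
  f (inord 0) - f (inord 1) + f (inord 2) - f (inord 3) + f (inord 4).
Proof.
rewrite !big_ord_recl big_ord0 addr0 !addrA.
by congr (f _ - f _ + f _ - f _ + f _); apply: val_inj; rewrite /= inordK.
Qed.

(** * Arithmetic of dual numbers *)

Section DualBloch.
Variable F : fieldType.
Local Notation D := (dual_ring F).
Implicit Types (a b : F) (z w t u : D).

Lemma coef_eps1D z w : coef_eps1 (z + w) = coef_eps1 z + coef_eps1 w.
Proof. by rewrite /coef_eps1 coefD. Qed.

Lemma coef_eps1N z : coef_eps1 (- z) = - coef_eps1 z.
Proof. by rewrite /coef_eps1 coefN. Qed.

Lemma coef_eps1_1 : coef_eps1 (1 : D) = 0.
Proof. by rewrite /coef_eps1 coefC. Qed.

(** The Leibniz rule: reduction modulo ['X^2] subtracts a multiple of ['X^2] and so keeps the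
    coefficient of degree 1. *)
Lemma coef_eps1M z w : coef_eps1 (z * w) =
  coef_eps0 z * coef_eps1 w + coef_eps1 z * coef_eps0 w.
Proof.
rewrite /coef_eps0 /coef_eps1 poly_of_qpolyM.
move: (polyn z) (polyn w) => p q; rewrite mk_monic_Xn.
transitivity (p * q)`_1; last by rewrite coefM !big_ord_recl big_ord0 addr0.
rewrite [in RHS](Pdiv.RingMonic.rdivp_eq (monicXn F 2) (p * q)).
by rewrite coefD coefMXn add0r.
Qed.

(** The quotient rule, read off from the Leibniz rule for [(z / w) * w]. *)
Lemma coef_eps1_div z w : w \is a GRing.unit -> coef_eps1 (z / w) =
  (coef_eps1 z * coef_eps0 w - coef_eps0 z * coef_eps1 w) / coef_eps0 w ^+ 2.
Proof.
move=> wU; move: (wU); rewrite dual_unit => w0.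
have e0 := coef_eps0M (z / w) w; have e1 := coef_eps1M (z / w) w.
rewrite !divrK // in e0 e1; rewrite e0 e1; field; exact: w0.
Qed.

Lemma dual_ext z w :
  coef_eps0 z = coef_eps0 w -> coef_eps1 z = coef_eps1 w -> z = w.
Proof.
move=> e0 e1; apply/val_inj/polyP => -[//|[//|n]].
have size2 (v : D) : (size (v : {poly F}) <= n.+2)%N.
  by apply: leq_trans (size_npoly v) _; rewrite mk_monic_Xn size_polyXn.
by rewrite (nth_default 0 (size2 z)) (nth_default 0 (size2 w)).
Qed.

Lemma coef_eps0_1B z : coef_eps0 (1 - z) = 1 - coef_eps0 z.
Proof. by rewrite (rmorphB (@coef_eps0 F)) rmorph1. Qed.

Lemma coef_eps1_1B z : coef_eps1 (1 - z) = - coef_eps1 z.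
Proof. by rewrite coef_eps1D coef_eps1N coef_eps1_1 add0r. Qed.

(** * The five-term relation for dual numbers *)

(** Indexing by a single dual number turns the primed terms of the five-term relation into
    coefficients of quotients. *)
Definition dual_class z : TB2 F := tclass (coef_eps0 z) (coef_eps1 z).

Lemma tclass_five_term a a' b b' :
    a != 0 -> a != 1 -> b != 0 -> b != 1 -> a != b ->
  tclass a a' - tclass b b' + tclass (b / a) ((a * b' - a' * b) / a ^+ 2)
  - tclass ((1 - b) / (1 - a))
           (((1 - b) * a' - (1 - a) * b') / (1 - a) ^+ 2)
  + tclass ((a * (1 - b)) / (b * (1 - a)))
           ((b * (1 - b) * a' - a * (1 - a) * b') / (b * (1 - a)) ^+ 2) = 0.
Proof.
move=> a0 a1 b0 b1 ab.
have Na1 : 1 - a != 0 by rewrite subr_eq0 eq_sym.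
have Nb1 : 1 - b != 0 by rewrite subr_eq0 eq_sym.
have Nbd : b * (1 - a) != 0 by rewrite mulf_neq0.
have div_neq1 (c d : F) : d != 0 -> c != d -> c / d != 1.
  by move=> d0; apply: contra => /eqP e; rewrite -[c](divfK d0) e mul1r.
rewrite /tclass -!(raddfB, raddfD); apply/zquot_pi_eq0/zspan_gen.
exists a, a', b, b'; split=> //.
(* [insubd] takes no default value here: the remaining goals check that the three quotients also
   avoid 0 and 1. *)
rewrite !(raddfB, raddfD) /= !val_tbracket //.
- by rewrite !(mulf_neq0, invr_eq0).
- apply: div_neq1 => //; apply: contra ab => /eqP e; apply/eqP.
  by move: e; rewrite !mulrBr !mulr1 [b * a]mulrC => /addIr.
- by rewrite !(mulf_neq0, invr_eq0).
- by apply: div_neq1 => //; apply: contra ab => /eqP /addrI /oppr_inj ->.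
- by rewrite !(mulf_neq0, invr_eq0).
- by apply: div_neq1; rewrite // eq_sym.
Qed.

Lemma dual_class_five_term z w :
    z \is a GRing.unit -> 1 - z \is a GRing.unit ->
    w \is a GRing.unit -> 1 - w \is a GRing.unit ->
    z - w \is a GRing.unit ->
  dual_class z - dual_class w + dual_class (w / z)
  - dual_class ((1 - w) / (1 - z))
  + dual_class ((z * (1 - w)) / (w * (1 - z))) = 0.
Proof.
move=> zU z1U wU w1U zwU.
have wzU : w * (1 - z) \is a GRing.unit by rewrite unitrM wU.
rewrite /dual_class !coef_eps1_div // !coef_eps1M !coef_eps1_1B.
rewrite !coef_eps0M !coef_eps0V -?dual_unit // !coef_eps0M !coef_eps0_1B.
move: zU z1U wU w1U zwU; rewrite !dual_unit !coef_eps0_1B.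
rewrite (rmorphB (@coef_eps0 F)) /= !subr_eq0 => z0 z1 w0 w1 zw.
have := @tclass_five_term (coef_eps0 z) (coef_eps1 z)
                          (coef_eps0 w) (coef_eps1 w).
move: (coef_eps0 z) (coef_eps1 z) (coef_eps0 w) (coef_eps1 w) z0 z1 w0 w1 zw.
move=> a a' b b' a0 a1 b0 b1 ab.
rewrite [a == 1]eq_sym [b == 1]eq_sym => /(_ a0 a1 b0 b1 ab) <-.
(* The numerators given by the quotient rule are matched with those in [five_term]. *)
have e1 : b' * a - b * a' = a * b' - a' * b by ring.
have e2 : - b' * (1 - a) - (1 - b) * - a' = (1 - b) * a' - (1 - a) * b' by ring.
have e3 : (a * - b' + a' * (1 - b)) * (b * (1 - a))
          - a * (1 - b) * (b * - a' + b' * (1 - a))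
          = b * (1 - b) * a' - a * (1 - a) * b' by ring.
by rewrite e1 e2 e3.
Qed.

(** * The inversion relation *)

Definition inv_defect z : TB2 F := dual_class z + dual_class z^-1.

Lemma inv_defectM t u :
    t \is a GRing.unit -> 1 - t \is a GRing.unit ->
    u \is a GRing.unit -> 1 - u \is a GRing.unit ->
    1 - t * u \is a GRing.unit ->
  inv_defect t + inv_defect (t * u) = inv_defect u.
Proof.
move=> tU t1U uU u1U tuU.
(* The solution of [x / y = t] and [(1 - y) / (1 - x) = u]; the last argument of the five-term
   relation at [(x, y)] is then [t * u]. *)
pose y := (1 - u) / (1 - t * u); pose x := t * y.
have yU : y \is a GRing.unit by rewrite unitrM u1U unitrV.
have xU : x \is a GRing.unit by rewrite unitrM tU.
have ey : y * (1 - t * u) = 1 - u by rewrite divrK.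
have ex1 : 1 - x = (1 - t) / (1 - t * u).
  by apply/esym/eq_divr => //; rewrite mulrBl /x -mulrA ey; ring.
have ey1 : 1 - y = u * (1 - x).
  by apply: (mulIr tuU); rewrite mulrBl ey ex1 mulrA divrK //; ring.
have x1U : 1 - x \is a GRing.unit by rewrite ex1 unitrM t1U unitrV.
have y1U : 1 - y \is a GRing.unit by rewrite ey1 unitrM uU.
have yxU : y - x \is a GRing.unit.
  by rewrite -[y in y - x]mul1r -mulrBl unitrM t1U.
have xyU : x - y \is a GRing.unit by rewrite -opprB unitrN.
have Rxy := dual_class_five_term xU x1U yU y1U xyU.
have Ryx := dual_class_five_term yU y1U xU x1U yxU.
have e1 : x / y = t by apply: eq_divr.
have e2 : (1 - y) / (1 - x) = u by apply: eq_divr.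
have e3 : (x * (1 - y)) / (y * (1 - x)) = t * u.
  apply: eq_divr; first by rewrite unitrM yU.
  by rewrite ey1 /x mulrACA.
have e1' : y / x = t^-1 by rewrite -e1 invr_div.
have e2' : (1 - x) / (1 - y) = u^-1 by rewrite -e2 invr_div.
have e3' : (y * (1 - x)) / (x * (1 - y)) = (t * u)^-1.
  by rewrite -e3 invr_div // unitrM ?xU ?yU.
rewrite e1' e2 e3 in Rxy; rewrite e1 e2' e3' in Ryx.
apply/subr0_eq; rewrite -[RHS](addr0 0) -[X in _ = X + _]Rxy.
rewrite -[X in _ = _ + X]Ryx /inv_defect opprD !addrA.
(* The six terms in [t], [u] and [t * u] come first; the classes of [x] and [y] come last and cancel
   in pairs. *)
rewrite [RHS](ACl (8*3*5*10*4*9*1*7*2*6))/=.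
by rewrite addrK subrK.
Qed.

Lemma dual_class_const z : coef_eps1 z = 0 -> dual_class z = 0.
Proof.
move=> z1; rewrite /dual_class z1 /tclass /tbracket subrr.
rewrite [insubd _ _](_ : _ = 0) ?raddf0 //.
by apply: val_inj; rewrite /insubd insubT ?rpred0 //= => ?; rewrite SubK.
Qed.

Lemma inv_defect_const z :
  z \is a GRing.unit -> coef_eps1 z = 0 -> inv_defect z = 0.
Proof.
move=> zU z1; rewrite /inv_defect !dual_class_const ?addr0 //.
by rewrite -div1r coef_eps1_div // z1 coef_eps1_1 mul0r mulr0 subr0 mul0r.
Qed.

Lemma inv_defect_sqr w :
    w \is a GRing.unit -> 1 - w \is a GRing.unit ->
    1 - w * w \is a GRing.unit -> inv_defect (w * w) = 0.
Proof.
by move=> *; apply: (addrI (inv_defect w)); rewrite addr0 inv_defectM.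
Qed.

Lemma dual_classV z : [pchar F] =i pred0 ->
    z \is a GRing.unit -> 1 - z \is a GRing.unit ->
  dual_class z^-1 = - dual_class z.
Proof.
move=> charF0 zU z1U; apply/eqP; rewrite -addr_eq0 addrC.
apply/eqP; rewrite -/(inv_defect z).
have nat_neq0 n : n.+1%:R != 0 :> F by rewrite (pcharf0P F).1.
have := zU; rewrite dual_unit; set z0 := coef_eps0 z => z0N.
pose z1 := coef_eps1 z.
(* The choices c = 2, 3 keep the constant factor z0 / c^2 of z away from 1. *)
have [c [c0 c1 c2 kN1]] : exists c : F,
    [/\ c != 0, 1 - c != 0, 1 - c ^+ 2 != 0 & z0 != c ^+ 2].
  have [z4|z4] := eqVneq z0 (2%:R ^+ 2); [exists 3%:R | exists 2%:R]; split=> //.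
  - by rewrite (_ : _ - _ = - 2%:R) ?oppr_eq0 //; ring.
  - by rewrite (_ : _ - _ = - 8%:R) ?oppr_eq0 //; ring.
  - by rewrite z4 -subr_eq0 (_ : _ - _ = - 5%:R) ?oppr_eq0 //; ring.
  - by rewrite (_ : _ - _ = - 1%:R) ?oppr_eq0 //; ring.
  - by rewrite (_ : _ - _ = - 3%:R) ?oppr_eq0 //; ring.
(* The second coefficient [b] solves [(z0 / c ^+ 2) * (2 * c * b) = z1], which makes
   [z = k * (w * w)]; this is where 2 is inverted. *)
pose w := dual c (c * z1 / (2%:R * z0)).
pose k := dual (z0 / c ^+ 2) 0.
have zE : z = k * (w * w).
  apply: dual_ext.
    by rewrite !coef_eps0M !coef_eps0_dual -expr2 divfK // expf_neq0.
  rewrite !(coef_eps1M, coef_eps0M, coef_eps0_dual, coef_eps1_dual) -/z1.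
  by field; rewrite z0N c0 (nat_neq0 1%N).
have w0 : coef_eps0 w = c by rewrite coef_eps0_dual.
have k0 : coef_eps0 k = z0 / c ^+ 2 by rewrite coef_eps0_dual.
have wU : w \is a GRing.unit by rewrite dual_unit w0.
have kU : k \is a GRing.unit.
  by rewrite dual_unit k0 mulf_neq0 ?invr_eq0 ?expf_neq0.
have w1U : 1 - w \is a GRing.unit by rewrite dual_unit coef_eps0_1B w0.
have w21U : 1 - w * w \is a GRing.unit.
  by rewrite dual_unit coef_eps0_1B coef_eps0M w0 -expr2.
have k1U : 1 - k \is a GRing.unit.
  rewrite dual_unit coef_eps0_1B k0 subr_eq0 eq_sym.
  apply: contra kN1 => /eqP k1; apply/eqP.
  by rewrite -[LHS](@divfK _ (c ^+ 2)) ?expf_neq0 // k1 mul1r.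
(* Multiplicativity gives [inv_defect k + inv_defect z = inv_defect (w * w)], and the defects of the
   constant [k] and of the square vanish. *)
have := @inv_defectM k (w * w); rewrite -zE unitrM wU.
rewrite inv_defect_sqr // inv_defect_const ?coef_eps1_dual // add0r //.
by apply.
Qed.

(** * The alternating sum over five points *)

Lemma sum_dual_class_cross_ratio (p : 'I_5 -> 'rV[D]_3) :
    [pchar F] =i pred0 ->
    (forall i j k, i != j -> i != k -> j != k ->
       Delta (p i) (p j) (p k) \is a GRing.unit) ->
  \sum_(i < 5) dual_class (cross_ratio_hat p i) *~ ((-1) ^+ i) = 0.
Proof.
move=> charF0 pU; rewrite alternating_sum5.
have rU n := cross_ratio_hat_unit pU (inord n).
have NrU n := subr1_cross_ratio_hat_unit pU (inord n).
move: (rU 0%N) (rU 1%N) (rU 3%N) (rU 4%N).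
move: (NrU 0%N) (NrU 1%N) (NrU 3%N) (NrU 4%N).
move: (subr_cross_ratio_hat_unit pU) (cross_ratio_hat_div pU).
move: (cross_ratio_hat_subr1_div pU) (cross_ratio_hat_mul_div pU).
move: (cross_ratio_hat p (inord 0)) (cross_ratio_hat p (inord 1)).
move: (cross_ratio_hat p (inord 2)) (cross_ratio_hat p (inord 3)).
move: (cross_ratio_hat p (inord 4)) => r4 r2 r3 r0 r1.
move=> e4 e3 r01U e2 Nr0U Nr1U Nr3U Nr4U r0U r1U r3U r4U.
have := dual_class_five_term r0U Nr0U r1U Nr1U r01U.
(* Inversion turns the terms at [r4^-1] and [r3^-1], with signs minus and plus, into [r4] with plus
   and [r3] with minus; only their order is left to exchange. *)
rewrite e2 e3 e4 !dual_classV // opprK => <-.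
exact: addrAC.
Qed.

End DualBloch.

Theorem lemma4p4 (F : fieldType) (charF0 : [pchar F] =i pred0)
    (x x' : 'I_5 -> 'rV[F]_3)
    (x_neq0 : forall i : 'I_5, x i != 0)
    (x_generic : forall i j k : 'I_5, i != j -> i != k -> j != k ->
       Delta (x i) (x j) (x k) != 0) :
  \sum_(i < 5) tclass (cross_ratio_hat x i) (r_eps x x' i) *~ ((-1) ^+ i)
  = 0 :> TB2 F.
Proof.
(* Both arguments of [tclass] are coefficients of one cross-ratio of dual points, whose determinants
   are units because their constant terms are nonzero. *)
rewrite -[RHS](@sum_dual_class_cross_ratio F
  (fun j => dual_row (x j) (x' j)) charF0).
  apply: eq_bigr => i _.
  by rewrite /dual_class coef_eps0_cross_ratio_hat.
by move=> i j k ij ik jk; rewrite dual_unit coef_eps0_Delta x_generic.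
Qed.
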